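(* Let $L>0$, $\nu\ge 0$, let $\mathbf r\in\mathbb R^3$ be a constant vector with $\mathbf r^{\mathrm T}\mathbf r=1$, and let $k>0$ be a constant. Consider the controlled Landau-Lifshitz equation for $\mathbf m(x,t)\in\mathbb R^3$, $x\in[0,L]$, $t\ge 0$, $$\frac{\partial \mathbf m}{\partial t}=\mathbf m\times\mathbf m_{xx}-\nu\,\mathbf m\times(\mathbf m\times\mathbf m_{xx})+k(\mathbf r-\mathbf m),\qquad \mathbf m(x,0)=\mathbf m_0(x),\qquad \mathbf m_x(0,t)=\mathbf m_x(L,t)=\mathbf 0,$$ of which $\mathbf r$ is an equilibrium point. If $k>8\nu L^4$, then $\mathbf r$ is a globally exponentially stable equilibrium point of this equation in the $H_1$-norm; that is, for any initial condition $\mathbf m_0\in H_1$, $\mathbf m$ decreases exponentially in the $H_1$-norm to $\mathbf r$.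
   Context: $\mathcal L_2^3=\mathcal L_2([0,L];\mathbb R^3)$ with its usual inner product and norm $\|\cdot\|_{\mathcal L_2^3}$; $\times$ is the cross product in $\mathbb R^3$; subscripts $x$, $xx$ denote first and second derivatives in $x$. The $H_1$-norm is defined by $\|\mathbf m\|_{H_1}^2=\|\mathbf m\|_{\mathcal L_2^3}^2+\|\mathbf m_x\|_{\mathcal L_2^3}^2$. The right-hand side of the equation is considered as an operator on $\mathcal L_2^3$ with domain $D=\{\mathbf m\in\mathcal L_2^3:\ \mathbf m_x\in\mathcal L_2^3,\ \mathbf m_{xx}\in\mathcal L_2^3,\ \mathbf m_x(0)=\mathbf m_x(L)=\mathbf 0\}$. The constant vector $\mathbf r$ is identified with the constant function on $[0,L]$. Globally exponentially stable in the $H_1$-norm means: there are constants $M\ge 1$, $\alpha>0$ (independent of the initial condition) such that $\|\mathbf m(\cdot,t)-\mathbf r\|_{H_1}\le M e^{-\alpha t}\|\mathbf m_0-\mathbf r\|_{H_1}$ for all $t\ge 0$ and every initial condition $\mathbf m_0\in H_1$. *)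

(* Defs.v *)
(* MathComp-Analysis development: real Lebesgue integration over an abstract
   [R : realType], vectors of R^3 as columns ['cV[R]_3]. *)
From HB Require Import structures.
From mathcomp Require Import all_boot all_order all_algebra.
From mathcomp Require Import all_classical all_reals all_analysis.

Set Implicit Arguments.
Unset Strict Implicit.
Unset Printing Implicit Defensive.

Import Order.TTheory GRing.Theory Num.Theory.
Import numFieldNormedType.Exports.

Local Open Scope classical_set_scope.
Local Open Scope ring_scope.

Section Vectors.
Variable R : realType.

Definition dotv (u v : 'cV[R]_3) : R := \sum_i u i 0 * v i 0.

(* Indices are added in the cyclic group 'I_3, so that the three entries are
   u1 v2 - u2 v1,  u2 v0 - u0 v2,  u0 v1 - u1 v0. *)
Definition crossv (u v : 'cV[R]_3) : 'cV[R]_3 :=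
  \col_i (u (i + 1) 0 * v (i + 2%:R) 0 - u (i + 2%:R) 0 * v (i + 1) 0).

End Vectors.

Section Spaces.
Variables (R : realType) (L : R).
Implicit Types u v : R -> 'cV[R]_3.

(* Functions on [0, L] are total functions on R; only their values on [0, L]
   matter in every definition below. *)

Definition inL2 u : Prop :=
  (forall i, measurable_fun `[0, L] (fun x => u x i 0)) /\
  (@lebesgue_measure R).-integrable `[0, L] (fun x => (dotv (u x) (u x))%:E).

Definition L2dot u v : R :=
  \int[@lebesgue_measure R]_(x in `[0, L]) dotv (u x) (v x).

Definition L2norm u : R := Num.sqrt (L2dot u u).

(* The x-derivative of u as a function on the interval [0, L]: the difference
   quotient is taken inside [0, L], hence it is one-sided at 0 and L, and does
   not depend on the values of u outside [0, L]. Where the limit does not exist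
   the value is irrelevant: for u in [inH1] this is a null set. *)
Definition dx u : R -> 'cV[R]_3 := fun x =>
  lim ((y - x)^-1 *: (u y - u x) @[y --> within `[0, L] x^']).

(* u and u_x are in L_2. The last clause says that u is (the absolutely
   continuous representative of) a function whose weak derivative is u_x; it
   excludes functions, such as jump or Cantor functions, whose a.e. derivative
   is not their weak derivative. *)
Definition inH1 u : Prop :=
  [/\ inL2 u, inL2 (dx u) &
      forall x, x \in `[0, L] ->
        u x = u 0 + \col_i \int[@lebesgue_measure R]_(y in `[0, x]) dx u y i 0].

Definition H1norm u : R := Num.sqrt (L2norm u ^+ 2 + L2norm (dx u) ^+ 2).

(* Here u_x is the continuous representative, so that its boundary values
   make sense. *)
Definition inD u : Prop :=
  [/\ inH1 u, inH1 (dx u), dx u 0 = 0 & dx u L = 0].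

End Spaces.

Section LandauLifshitz.
Variables (R : realType) (L nu k : R) (r : 'cV[R]_3).

Definition LLrhs (u : R -> 'cV[R]_3) : R -> 'cV[R]_3 := fun x =>
  let uxx := dx L (dx L u) x in
  crossv (u x) uxx - nu *: crossv (u x) (crossv (u x) uxx) + k *: (r - u x).

(* m t x stands for m(x, t). A solution on [0, +oo[ is a continuous trajectory
   in H_1 (that is, m and m_x are continuous in time for the L_2 norm) which,
   for every t > 0, lies in the domain D and is differentiable in time for the
   L_2 norm, with derivative the right-hand side. *)
Definition LLsolution (m0 : R -> 'cV[R]_3) (m : R -> R -> 'cV[R]_3) : Prop :=
  [/\ forall x, x \in `[0, L] -> m 0 x = m0 x,
      forall t, 0 <= t -> inH1 L (m t),
      forall t, 0 <= t ->
        L2norm L (fun x => m s x - m t x)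
          @[s --> within `[0, +oo[ (nbhs t)] --> (0 : R) /\
        L2norm L (fun x => dx L (m s) x - dx L (m t) x)
          @[s --> within `[0, +oo[ (nbhs t)] --> (0 : R),
      forall t, 0 < t -> inD L (m t) &
      forall t, 0 < t ->
        L2norm L (fun x => h^-1 *: (m (t + h) x - m t x) - LLrhs (m t) x)
          @[h --> 0^'] --> (0 : R)].

Definition LLequilibrium (p : 'cV[R]_3) : Prop :=
  inD L (cst p) /\ forall x, x \in `[0, L] -> LLrhs (cst p) x = 0.

Definition LLglobally_exp_stable_H1 (p : 'cV[R]_3) : Prop :=
  exists M alpha : R, [/\ 1 <= M, 0 < alpha &
    forall (m0 : R -> 'cV[R]_3) (m : R -> R -> 'cV[R]_3),
      inH1 L m0 -> LLsolution m0 m ->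
      forall t, 0 <= t ->
        H1norm L (fun x => m t x - p) <=
          M * expR (- alpha * t) * H1norm L (fun x => m0 x - p)].

End LandauLifshitz.

(* Main.v *)
Require Import Defs.
From mathcomp Require Import all_boot all_order all_algebra.
From mathcomp Require Import all_classical all_reals all_analysis.
From mathcomp Require Import measurable_realfun ring lra.

Set Implicit Arguments.
Unset Strict Implicit.
Unset Printing Implicit Defensive.

Import Order.TTheory GRing.Theory Num.Theory.
Import numFieldNormedType.Exports.

Local Open Scope classical_set_scope.
Local Open Scope ring_scope.

(** The proof is a Lyapunov argument for the weighted energy
      [V(u) = |u - r|^2 + c |u_x|^2]   (norms of L_2),
    with [c = 1 + nu / (2 k)].  Since [c >= 1], [V] is squeezed between the
    square of the H_1-norm of [u - r] and [c] times it, so an exponential decay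
    of [V] along solutions gives the theorem, with [M = sqrt c].

    Dissipation.  Formally [V' = 2 <u - r - c u_xx, F>], [F] being the
    right-hand side of the equation.  Expanding the product pointwise, with
    [z = u x u_xx], the damping term contributes [- c nu |z|^2] through [u_xx]
    and [nu r . (u x z) = nu r . ((u - r) x z)] through [u - r]; as [|r| = 1],
    Young's inequality absorbs the latter into the former at the price of
    [nu / (4 c) |u - r|^2] ([dissipation_le]).  The precession term contributes
    [- r . (u x u_xx)], whose integral vanishes after one integration by parts,
    and the feedback contributes [- k V] to [<u - r - c u_xx, F>].  Altogether
    [V' <= - 2 (k - nu / (4 c)) |u - r|^2 - 2 c k |u_x|^2 <= - k V]
    ([energy_dissipation]).

    Differentiability.  A solution is differentiable in time for the L_2-norm
    only, so [u_x] need not be differentiable in time and [V'] may fail to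
    exist.  However [V] is convex and, for [u] in the domain, its subgradient
    [2 (u - r - c u_xx)] is in L_2.  Hence
    [V(m(t)) - V(m(s)) <= 2 <subgradient at m(t), m(t) - m(s)>]
    ([energy_diff_le]), and for [s < t] this bounds the left upper Dini
    derivative of [V] by the formal one ([energy_left_decay]).  Continuity of
    the trajectory in H_1 makes [V] continuous in time, and a continuous
    function whose left Dini derivative is at most [- k V] decays at every
    exponential rate smaller than [k] ([left_decay_exp]).

    Integration by parts is needed for functions that are only integrals of
    their L_1 derivatives ([primitive_by_parts]). *)

(** * Integration by parts for primitives of integrable functions *)

(** Halving an interval according to the values of [S] halves the sum of the
    squared increments of [S], so repeated bisection makes the bound on the
    increment of [H] arbitrarily small. *)
Lemma eq_of_quadratic_increment (R : realType) (a b : R) (S H : R -> R) :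
  a <= b -> {within `[a, b], continuous S} ->
  (forall x y, a <= x -> x <= y -> y <= b ->
     `|H y - H x| <= (S y - S x) ^+ 2) ->
  H a = H b.
Proof.
move=> ab cS HS.
have bisect (n : nat) x y : a <= x -> x <= y -> y <= b ->
    `|H y - H x| <= 2^-1 ^+ n * (S y - S x) ^+ 2.
  elim: n x y => [|n IHn] x y ax xy yb; first by rewrite expr0 mul1r HS.
  have cSxy : {within `[x, y], continuous S}.
    apply: continuous_subspaceW cS => z /=.
    by rewrite !in_itv/= => /andP[xz zy]; rewrite (le_trans ax)//= (le_trans zy).
  have [|c] := IVT (v := (S x + S y) / 2) xy cSxy.
    by case: (lerP (S x) (S y)) => Sxy; apply/andP; split; lra.
  rewrite in_itv/= => /andP[xc cy] Sc.
  have Hxc := IHn _ _ ax xc (le_trans cy yb).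
  have Hcy := IHn _ _ (le_trans ax xc) cy yb.
  rewrite -(subrK (H c) (H y)) -addrA (le_trans (ler_normD _ _))//.
  rewrite (le_trans (lerD Hcy Hxc))// Sc (exprS _ n); set e := _ ^+ n.
  by rewrite le_eqVlt; apply/orP; left; apply/eqP; field.
apply/eqP; rewrite eq_sym -subr_eq0 -normr_le0; apply/ler_addgt0Pr => e e0.
rewrite add0r.
have : 2^-1 ^+ n * (S b - S a) ^+ 2 @[n --> \oo] --> (0 : R).
  rewrite -(mul0r ((S b - S a) ^+ 2)); apply: cvgMr_tmp.
  by apply: cvg_expr; rewrite ger0_norm ?invf_lt1// ltr1n.
move=> /cvgr0Pnorm_le/(_ _ e0)[n _ /(_ n (leqnn n))] /=.
apply: le_trans; apply: le_trans (ler_norm _).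
exact: bisect.
Qed.

Section RealIntegrable.
Context d (T : measurableType d) (R : realType).
Variables (mu : {measure set T -> \bar R}) (D : set T).
Hypothesis mD : measurable D.
Implicit Types f g : T -> R.

Lemma integrable_EFinD f g : mu.-integrable D (EFin \o f) ->
  mu.-integrable D (EFin \o g) ->
  mu.-integrable D (EFin \o (fun x => f x + g x)).
Proof. by move=> fi gi; apply: eq_integrable (integrableD mD fi gi). Qed.

Lemma integrable_EFinB f g : mu.-integrable D (EFin \o f) ->
  mu.-integrable D (EFin \o g) ->
  mu.-integrable D (EFin \o (fun x => f x - g x)).
Proof. by move=> fi gi; apply: eq_integrable (integrableB mD fi gi). Qed.

Lemma integrable_EFinZl (c : R) f : mu.-integrable D (EFin \o f) ->
  mu.-integrable D (EFin \o (fun x => c * f x)).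
Proof. by move=> fi; apply: eq_integrable (integrableZl mD c fi). Qed.

End RealIntegrable.

Section Primitives.
Context {R : realType}.
Notation mu := (@lebesgue_measure R).

(** Absolute continuity of [f] on [[0, L]] with derivative [f'], stated as the
    fundamental theorem of calculus so that no almost-everywhere derivative is
    involved. *)
Definition primitive (L : R) (f f' : R -> R) : Prop :=
  mu.-integrable `[0, L] (EFin \o f') /\
  forall x, x \in `[0, L] -> f x = f 0 + \int[mu]_(y in `[0, x]) f' y.

Lemma primitive_increment (L : R) (f f' : R -> R) (a b : R) :
  primitive L f f' -> 0 <= a -> a <= b -> b <= L ->
  f b - f a = \int[mu]_(y in `]a, b]) f' y.
Proof.
move=> [f'i fE] a0 ab bL; have b0 := le_trans a0 ab.
rewrite (fE b) ?in_itv/= ?b0// (fE a) ?in_itv/= ?a0 ?(le_trans ab)//.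
have f'bi : mu.-integrable `[0, b] (EFin \o f').
  by apply: integrableS f'i => //; apply: subset_itvl; rewrite bnd_simp.
by rewrite -(Rintegral_itvB f'bi) ?bnd_simp//; ring.
Qed.

Lemma primitive_continuous (L : R) (f f' : R -> R) :
  0 <= L -> primitive L f f' -> {within `[0, L], continuous f}.
Proof.
move=> L0 [f'i fE].
apply: (@subspace_eq_continuous _ _ _
  ((fun=> f 0) + (fun x => parameterized_integral mu 0 x f'))).
  by move=> x; rewrite inE/= => x0L; exact/esym/fE.
apply: within_continuousD; first exact: cst_continuous.
exact: (parameterized_integral_continuous L0 f'i).
Qed.

Lemma primitive_measurable (L : R) (f f' : R -> R) :
  0 <= L -> primitive L f f' -> measurable_fun `[0, L] f.
Proof.
move=> L0 pf; apply: subspace_continuous_measurable_fun => //.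
exact: primitive_continuous pf.
Qed.

Lemma primitive_bounded (L : R) (f f' : R -> R) :
  0 <= L -> primitive L f f' -> [bounded f x | x in `[0, L]].
Proof.
move=> L0 pf.
have : bounded_set (f @` `[0, L]).
  apply: compact_bounded; apply: continuous_compact.
    exact: primitive_continuous pf.
  exact: segment_compact.
by case=> M [Mr fM]; exists M; split=> // x /fM + y /= y0L; apply; exists y.
Qed.

Lemma primitive_integral (L : R) (s : R -> R) :
  mu.-integrable `[0, L] (EFin \o s) ->
  primitive L (fun x => \int[mu]_(y in `[0, x]) s y) s.
Proof. by move=> si; split=> // x _; rewrite set_itv1 Rintegral_set1 add0r. Qed.

Lemma integrable_sub_itv (L a b : R) (s : R -> R) : 0 <= a -> b <= L ->
  mu.-integrable `[0, L] (EFin \o s) -> mu.-integrable `]a, b] (EFin \o s).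
Proof.
move=> a0 bL; apply: integrableS => //.
by apply: subset_itv; rewrite bnd_simp.
Qed.

Lemma primitive_increment_le (L : R) (f f' S s : R -> R) (a b : R) :
  primitive L f f' -> primitive L S s ->
  (forall x, x \in `[0, L] -> `|f' x| <= s x) ->
  0 <= a -> a <= b -> b <= L -> `|f b - f a| <= S b - S a.
Proof.
move=> pf pS f's a0 ab bL.
rewrite (primitive_increment pf)// (primitive_increment pS)//.
have f'i := integrable_sub_itv a0 bL pf.1.
apply: le_trans (le_normr_Rintegral _ f'i) _ => //.
apply: le_Rintegral => //.
- exact: integrable_norm f'i.
- exact: integrable_sub_itv pS.1.
- move=> x /=; rewrite in_itv/= => /andP[ax xb]; apply: f's.
  by rewrite in_itv/= (le_trans a0 (ltW ax)) (le_trans xb).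
Qed.

Lemma primitive_mul_integrable (L : R) (f f' g : R -> R) :
  0 <= L -> primitive L f f' -> mu.-integrable `[0, L] (EFin \o g) ->
  mu.-integrable `[0, L] (EFin \o (fun x => f x * g x)).
Proof.
move=> L0 pf gi.
apply: eq_integrable (integrableMr _ _ _ gi) => //.
- exact: primitive_measurable pf.
- exact: primitive_bounded pf.
Qed.

(** On a subinterval where the primitive [S] of [`|f'| + `|g'|] grows by
    [delta], both [f] and [g] oscillate by at most [delta], so [f g] and the
    integral of [f g' + g f'] have increments that differ by at most
    [delta ^+ 2].  By bisection the two increments agree over [[0, L]]. *)
Lemma primitive_by_parts (L : R) (f f' g g' : R -> R) : 0 <= L ->
  primitive L f f' -> primitive L g g' ->
  \int[mu]_(x in `[0, L]) (f x * g' x) + \int[mu]_(x in `[0, L]) (g x * f' x)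
    = f L * g L - f 0 * g 0.
Proof.
move=> L0 pf pg.
pose s x := `|f' x| + `|g' x|; pose h x := f x * g' x + g x * f' x.
have fgi := primitive_mul_integrable L0 pf pg.1.
have gfi := primitive_mul_integrable L0 pg pf.1.
have hi : mu.-integrable `[0, L] (EFin \o h) by exact: integrable_EFinD fgi gfi.
have si : mu.-integrable `[0, L] (EFin \o s).
  by apply: integrable_EFinD => //; apply: integrable_norm; [exact: pf.1|exact: pg.1].
have pS := primitive_integral si; have pH := primitive_integral hi.
set S := fun x => _ in pS; set H := fun x => _ in pH.
suff : f 0 * g 0 - H 0 = f L * g L - H L.
  rewrite /H set_itv1 Rintegral_set1 RintegralD//; lra.
apply: (@eq_of_quadratic_increment _ _ _ S (fun x => f x * g x - H x)) => //.
  exact: primitive_continuous pS.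
move=> x y x0 xy yL.
have f'i := integrable_sub_itv x0 yL pf.1.
have g'i := integrable_sub_itv x0 yL pg.1.
have -> : f y * g y - H y - (f x * g x - H x) =
    \int[mu]_(t in `]x, y]) ((f y * g' t + g x * f' t) - h t).
  rewrite RintegralB// -?(primitive_increment pH)//.
    rewrite RintegralD ?RintegralZl//.
    + by rewrite -(primitive_increment pf)// -(primitive_increment pg)//; ring.
    + exact: integrable_EFinZl.
    + exact: integrable_EFinZl.
  - by apply: integrable_EFinD => //; exact: integrable_EFinZl.
  - exact: integrable_sub_itv hi.
have di : mu.-integrable `]x, y]
    (EFin \o (fun t => (f y * g' t + g x * f' t) - h t)).
  apply: integrable_EFinB => //; last exact: integrable_sub_itv hi.
  by apply: integrable_EFinD => //; exact: integrable_EFinZl.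
apply: le_trans (le_normr_Rintegral _ di) _ => //.
rewrite expr2 {2}(primitive_increment pS)// -RintegralZl//; last first.
  exact: integrable_sub_itv si.
apply: le_Rintegral => //.
- exact: integrable_norm di.
- by apply: integrable_EFinZl => //; exact: integrable_sub_itv si.
move=> t /=; rewrite in_itv/= => /andP[/ltW xt ty].
have t0 := le_trans x0 xt; have tL := le_trans ty yL.
have Df : `|f y - f t| <= S y - S t.
  by apply: primitive_increment_le pf pS _ _ _ _ => // z _; rewrite lerDl.
have Dg : `|g t - g x| <= S t - S x.
  by apply: primitive_increment_le pg pS _ _ _ _ => // z _; rewrite lerDr.
have -> : f y * g' t + g x * f' t - h t =
  (f y - f t) * g' t - (g t - g x) * f' t by rewrite /h; ring.
rewrite (le_trans (ler_normB _ _))// !normrM /s mulrDr addrC lerD//.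
- by rewrite ler_wpM2r// (le_trans Dg)// lerD2r; have := normr_ge0 (f y - f t); lra.
- by rewrite ler_wpM2r// (le_trans Df)// lerD2l lerN2; have := normr_ge0 (g t - g x); lra.
Qed.

End Primitives.

(** * Algebra of vectors of dimension three *)

Section VectorAlgebra.
Context {R : realType}.
Implicit Types (u v w r : 'cV[R]_3) (a : R).

Lemma dotvC u v : dotv u v = dotv v u.
Proof. by apply: eq_bigr => i _; rewrite mulrC. Qed.

Lemma dotvDl u v w : dotv (u + v) w = dotv u w + dotv v w.
Proof. by rewrite -big_split; apply: eq_bigr => i _; rewrite mxE mulrDl. Qed.

Lemma dotvZl a u v : dotv (a *: u) v = a * dotv u v.
Proof. by rewrite mulr_sumr; apply: eq_bigr => i _; rewrite mxE mulrA. Qed.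

Lemma dotvNl u v : dotv (- u) v = - dotv u v.
Proof. by rewrite -scaleN1r dotvZl mulN1r. Qed.

Lemma dotvDr u v w : dotv u (v + w) = dotv u v + dotv u w.
Proof. by rewrite dotvC dotvDl !(dotvC u). Qed.

Lemma dotvZr a u v : dotv u (a *: v) = a * dotv u v.
Proof. by rewrite dotvC dotvZl dotvC. Qed.

Lemma dotvNr u v : dotv u (- v) = - dotv u v.
Proof. by rewrite dotvC dotvNl dotvC. Qed.

Lemma dotv_ge0 u : 0 <= dotv u u.
Proof. by apply: sumr_ge0 => i _; rewrite -expr2 sqr_ge0. Qed.

Lemma dotv_young u v : `|2 * dotv u v| <= dotv u u + dotv v v.
Proof.
have := dotv_ge0 (u + v); have := dotv_ge0 (u - v).
rewrite !(dotvDl, dotvDr, dotvNl, dotvNr) (dotvC v u) ler_norml => ? ?.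
by apply/andP; split; lra.
Qed.

Lemma dotvE u v :
  dotv u v = u 0 0 * v 0 0 + u 1 0 * v 1 0 + u 2%:R 0 * v 2%:R 0.
Proof.
rewrite /dotv !big_ord_recl big_ord0 addr0 addrA.
by congr (_ * _ + _ * _ + _ * _); congr (fun_of_matrix _ _ _); apply: val_inj.
Qed.

Lemma crossvE u v : [/\ crossv u v 0 0 = u 1 0 * v 2%:R 0 - u 2%:R 0 * v 1 0,
  crossv u v 1 0 = u 2%:R 0 * v 0 0 - u 0 0 * v 2%:R 0 &
  crossv u v 2%:R 0 = u 0 0 * v 1 0 - u 1 0 * v 0 0].
Proof.
have e0 : (1 + 2%:R : 'I_3) = 0 by apply: val_inj.
have e1 : (2%:R + 1 : 'I_3) = 0 by apply: val_inj.
have e2 : (1 + 1 : 'I_3) = 2%:R by apply: val_inj.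
have e3 : (2%:R + 2%:R : 'I_3) = 1 by apply: val_inj.
by rewrite /crossv !mxE !add0r e0 e1 e2 e3.
Qed.

Lemma dotv_crossv_sqr u v :
  dotv (crossv u v) (crossv u v) = dotv u u * dotv v v - dotv u v ^+ 2.
Proof. by rewrite !dotvE; have [-> -> ->] := crossvE u v; ring. Qed.

Lemma dotv_crossv_cycle u v w : dotv u (crossv v w) = dotv v (crossv w u).
Proof.
rewrite !dotvE; have [-> -> ->] := crossvE v w.
by have [-> -> ->] := crossvE w u; ring.
Qed.

Lemma crossvBl u v w : crossv (u - v) w = crossv u w - crossv v w.
Proof. by apply/matrixP => i j; rewrite !mxE; ring. Qed.

Lemma crossvC u v : crossv u v = - crossv v u.
Proof. by apply/matrixP => i j; rewrite !mxE; ring. Qed.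

Lemma crossv0 u : crossv u 0 = 0.
Proof. by apply/matrixP => i j; rewrite !mxE; ring. Qed.

(** The triple product is [d . (z x r)], where [z x r] is no longer than [z]
    since [r] is a unit vector; the bound is then [0 <= |d - 2 c (z x r)|^2]. *)
Lemma triple_young r d z (c : R) : dotv r r = 1 ->
  4 * c * dotv r (crossv d z) <= dotv d d + 4 * c ^+ 2 * dotv z z.
Proof.
move=> r1; rewrite dotv_crossv_cycle; set y := crossv z r.
have yz : dotv y y <= dotv z z.
  by rewrite dotv_crossv_sqr r1 mulr1 gerBl sqr_ge0.
have := dotv_ge0 (d - (2 * c) *: y).
rewrite !(dotvDl, dotvDr, dotvNl, dotvNr, dotvZl, dotvZr) (dotvC y d).
have := sqr_ge0 c; nra.
Qed.

Lemma dotv_crossv_l u v : dotv u (crossv u v) = 0.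
Proof. by rewrite dotvE; have [-> -> ->] := crossvE u v; ring. Qed.

Lemma dotv_crossv_r u v : dotv v (crossv u v) = 0.
Proof. by rewrite dotvE; have [-> -> ->] := crossvE u v; ring. Qed.

(** With [w = u_xx], the right-hand side of the equation is tested against
    half the gradient of the energy.  The damping term tested against [- c w]
    yields [- c nu |u x w|^2], which pays for the same term tested against
    [u - r]. *)
Lemma dissipation_le (nu k c : R) u w r : 0 <= nu -> 0 < c -> dotv r r = 1 ->
  dotv (u - r - c *: w)
    (crossv u w - nu *: crossv u (crossv u w) + k *: (r - u)) <=
  - dotv r (crossv u w) - (k - nu / (4 * c)) * dotv (u - r) (u - r)
  + c * k * dotv w (u - r).
Proof.
move=> nu0 c0 r1; set z := crossv u w.
have rz : 4 * c * dotv r (crossv u z) <=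
    dotv (u - r) (u - r) + 4 * c ^+ 2 * dotv z z.
  apply: le_trans (triple_young _ _ _ r1).
  by rewrite crossvBl dotvDr dotvNr dotv_crossv_l subr0.
have wz : dotv w (crossv u z) = - dotv z z.
  by rewrite dotv_crossv_cycle dotv_crossv_cycle crossvC dotvNr.
have -> : r - u = - (u - r) by rewrite opprB.
have -> : dotv (u - r - c *: w) (z - nu *: crossv u z + k *: - (u - r)) =
    - dotv r z + nu * dotv r (crossv u z) - c * nu * dotv z z
    - k * dotv (u - r) (u - r) + c * k * dotv w (u - r).
  rewrite [LHS]dotvDr [in X in _ + X]dotvZr dotvNr [dotv (_ - _ - _) (u - r)]dotvDl.
  rewrite dotvNl dotvZl; set q := dotv (u - r) _; set p := dotv w (u - r).
  rewrite !(dotvDl, dotvDr, dotvNl, dotvNr, dotvZl, dotvZr) wz.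
  by rewrite !dotv_crossv_l /z dotv_crossv_r -/z; ring.
suff : nu * dotv r (crossv u z) <=
    nu / (4 * c) * dotv (u - r) (u - r) + c * nu * dotv z z by lra.
have := ler_wpM2l (divr_ge0 nu0 (mulr_ge0 (ler0n R 4) (ltW c0))) rz.
suff -> : nu / (4 * c) * (4 * c * dotv r (crossv u z)) =
    nu * dotv r (crossv u z).
  move/le_trans; apply; rewrite le_eqVlt; apply/orP; left; apply/eqP.
  by field; rewrite gt_eqF.
by field; rewrite gt_eqF.
Qed.

End VectorAlgebra.

(** * Vector-valued square-integrable functions *)

Section L2Space.
Context {R : realType} (L : R).
Notation mu := (@lebesgue_measure R).
Implicit Types u v w : R -> 'cV[R]_3.

Let mL : measurable (`[0, L] : set (measurableTypeR R)).
Proof. exact: measurable_itv. Qed.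

Lemma eq_inL2 u v : {in `[0, L], u =1 v} -> inL2 L u -> inL2 L v.
Proof.
move=> uv [mu_ ui]; split=> [i|].
  apply: eq_measurable_fun (mu_ i) => x; rewrite inE/= => xL.
  by rewrite uv.
apply: eq_integrable ui => // x; rewrite inE/= => xL.
by rewrite uv.
Qed.

Lemma eq_L2dot u u' v v' : {in `[0, L], u =1 u'} -> {in `[0, L], v =1 v'} ->
  L2dot L u v = L2dot L u' v'.
Proof.
by move=> uu vv; apply: eq_Rintegral => x; rewrite inE/= => xL; rewrite uu// vv.
Qed.

Lemma measurable_dotv u v :
  (forall i, measurable_fun `[0, L] (fun x => u x i 0)) ->
  (forall i, measurable_fun `[0, L] (fun x => v x i 0)) ->
  measurable_fun `[0, L] (fun x => dotv (u x) (v x)).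
Proof.
by move=> mu_ mv; apply: measurable_sum => i; exact: measurable_funM.
Qed.

Lemma integrable_dotv u v : inL2 L u -> inL2 L v ->
  mu.-integrable `[0, L] (EFin \o (fun x => dotv (u x) (v x))).
Proof.
move=> [mu_ ui] [mv vi]; apply: le_integrable (integrable_EFinD mL ui vi) => //.
  by apply/measurable_EFinP; exact: measurable_dotv.
move=> x _ /=; rewrite lee_fin.
have := dotv_young (u x) (v x); rewrite normrM ger0_norm//.
have := ler_norm (dotv (u x) (u x) + dotv (v x) (v x)).
have := normr_ge0 (dotv (u x) (v x)); lra.
Qed.

Lemma inL2Z (a : R) u : inL2 L u -> inL2 L (fun x => a *: u x).
Proof.
move=> [mu_ ui]; split=> [i|].
  have -> : (fun x => (a *: u x) i 0) = (fun x => a * u x i 0).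
    by apply/funext => x; rewrite mxE.
  exact: measurable_funM.
apply: eq_integrable (integrable_EFinZl mL (a ^+ 2) ui) => // x _ /=.
by rewrite dotvZl dotvZr mulrA.
Qed.

Lemma inL2D u v : inL2 L u -> inL2 L v -> inL2 L (fun x => u x + v x).
Proof.
move=> u2 v2; split=> [i|].
  have -> : (fun x => (u x + v x) i 0) = (fun x => u x i 0 + v x i 0).
    by apply/funext => x; rewrite mxE.
  by apply: measurable_funD; [exact: u2.1|exact: v2.1].
apply: eq_integrable (integrable_EFinD mL (integrable_EFinD mL u2.2
  (integrable_EFinZl mL 2 (integrable_dotv u2 v2))) v2.2) => // x _ /=.
by rewrite !(dotvDl, dotvDr) (dotvC (v x)); congr _%:E; ring.
Qed.

Lemma inL2N u : inL2 L u -> inL2 L (fun x => - u x).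
Proof. by move=> /(inL2Z (-1)); apply: eq_inL2 => x _; rewrite scaleN1r. Qed.

Lemma inL2B u v : inL2 L u -> inL2 L v -> inL2 L (fun x => u x - v x).
Proof. by move=> u2 /inL2N; exact: inL2D. Qed.

Lemma inL2_bounded u (C : R) :
  (forall i, measurable_fun `[0, L] (fun x => u x i 0)) ->
  (forall x, x \in `[0, L] -> dotv (u x) (u x) <= C) -> inL2 L u.
Proof.
move=> mu_ uC; split=> //.
apply: (measurable_bounded_integrable mL).
- change (mu `[0%R, L]%classic < +oo)%E.
  by rewrite lebesgue_measure_itv/=; case: ifP => _ //; rewrite -EFinB ltry.
- exact: measurable_dotv.
- exists C; split; first exact: num_real.
  by move=> y Cy x /= xL; rewrite ger0_norm ?dotv_ge0// (le_trans _ (ltW Cy)) ?uC.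
Qed.

Lemma inL2_crossv u v (C : R) :
  (forall i, measurable_fun `[0, L] (fun x => u x i 0)) ->
  (forall x, x \in `[0, L] -> dotv (u x) (u x) <= C) ->
  inL2 L v -> inL2 L (fun x => crossv (u x) (v x)).
Proof.
move=> mu_ uC [mv vi].
have muv i : measurable_fun `[0, L] (fun x => crossv (u x) (v x) i 0).
  have -> : (fun x => crossv (u x) (v x) i 0) = (fun x =>
      u x (i + 1) 0 * v x (i + 2%:R) 0 - u x (i + 2%:R) 0 * v x (i + 1) 0).
    by apply/funext => x; rewrite mxE.
  by apply: measurable_funB; exact: measurable_funM.
split=> //; apply: le_integrable (integrable_EFinZl mL C vi) => //.
  by apply/measurable_EFinP; exact: measurable_dotv.
move=> x /= xL; rewrite lee_fin ger0_norm ?dotv_ge0//.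
rewrite (le_trans _ (ler_norm _))// dotv_crossv_sqr.
have := uC x xL; have := dotv_ge0 (v x); have := sqr_ge0 (dotv (u x) (v x)).
nra.
Qed.

Lemma L2dotC u v : L2dot L u v = L2dot L v u.
Proof. by apply: eq_Rintegral => x _; exact: dotvC. Qed.

Lemma L2dotDl u v w : inL2 L u -> inL2 L v -> inL2 L w ->
  L2dot L (fun x => u x + v x) w = L2dot L u w + L2dot L v w.
Proof.
move=> u2 v2 w2; rewrite /L2dot -RintegralD//; try exact: integrable_dotv.
by apply: eq_Rintegral => x _; exact: dotvDl.
Qed.

Lemma L2dotZl (a : R) u v : inL2 L u -> inL2 L v ->
  L2dot L (fun x => a *: u x) v = a * L2dot L u v.
Proof.
move=> u2 v2; rewrite /L2dot -RintegralZl//; try exact: integrable_dotv.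
by apply: eq_Rintegral => x _; exact: dotvZl.
Qed.

Lemma L2dotBl u v w : inL2 L u -> inL2 L v -> inL2 L w ->
  L2dot L (fun x => u x - v x) w = L2dot L u w - L2dot L v w.
Proof.
move=> u2 v2 w2; rewrite /L2dot -RintegralB//; try exact: integrable_dotv.
by apply: eq_Rintegral => x _; rewrite dotvDl dotvNl.
Qed.

Lemma L2dotDr u v w : inL2 L u -> inL2 L v -> inL2 L w ->
  L2dot L w (fun x => u x + v x) = L2dot L w u + L2dot L w v.
Proof. by move=> *; rewrite L2dotC L2dotDl// !(L2dotC w). Qed.

Lemma L2dotBr u v w : inL2 L u -> inL2 L v -> inL2 L w ->
  L2dot L w (fun x => u x - v x) = L2dot L w u - L2dot L w v.
Proof. by move=> *; rewrite L2dotC L2dotBl// !(L2dotC w). Qed.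

Lemma L2dotZr (a : R) u v : inL2 L u -> inL2 L v ->
  L2dot L v (fun x => a *: u x) = a * L2dot L v u.
Proof. by move=> *; rewrite L2dotC L2dotZl// (L2dotC v). Qed.

Lemma L2dot_ge0 u : 0 <= L2dot L u u.
Proof. by apply: Rintegral_ge0 => x _; exact: dotv_ge0. Qed.

Lemma L2norm_sqr u : L2norm L u ^+ 2 = L2dot L u u.
Proof. by rewrite sqr_sqrtr ?L2dot_ge0. Qed.

Lemma L2norm_ge0 u : 0 <= L2norm L u.
Proof. exact: sqrtr_ge0. Qed.

Lemma L2dot_sqr_le u v : inL2 L u -> inL2 L v ->
  L2dot L u v ^+ 2 <= L2dot L u u * L2dot L v v.
Proof.
move=> u2 v2; set X := L2dot L u v; set A := L2dot L u u; set B := L2dot L v v.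
have quad t : 0 <= A - 2 * t * X + t ^+ 2 * B.
  have tv := inL2Z t v2; have := L2dot_ge0 (fun x => u x - t *: v x).
  rewrite L2dotBl ?L2dotBr ?L2dotZl ?L2dotZr//; try exact: inL2B.
  by rewrite (L2dotC v) -/X -/A -/B; lra.
have A0 : 0 <= A by exact: L2dot_ge0.
have := L2dot_ge0 v; rewrite -/B le_eqVlt => /predU1P[B0|B0].
  have [->|X0] := eqVneq X 0; first by rewrite -B0; lra.
  (* For [B = 0] the polynomial [quad] is affine: this [t] makes it [-1]. *)
  have := quad ((A + 1) / (2 * X)); rewrite -B0.
  suff -> : 2 * ((A + 1) / (2 * X)) * X = A + 1 by lra.
  by field.
(* The minimizer of [quad]. *)
have := quad (X / B).
have -> : A - 2 * (X / B) * X + (X / B) ^+ 2 * B = A - X ^+ 2 / B.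
  by field; rewrite gt_eqF.
by rewrite subr_ge0 ler_pdivrMr.
Qed.

Lemma L2dot_le_norm u v : inL2 L u -> inL2 L v ->
  `|L2dot L u v| <= L2norm L u * L2norm L v.
Proof.
move=> u2 v2; rewrite -(@ler_pXn2r _ 2)// ?nnegrE ?mulr_ge0 ?L2norm_ge0//.
by rewrite real_normK ?num_real// exprMn !L2norm_sqr L2dot_sqr_le.
Qed.

(** This makes the energy continuous along a trajectory continuous in H_1. *)
Lemma L2norm_sqr_dist u v : inL2 L u -> inL2 L v ->
  let d := L2norm L (fun x => u x - v x) in
  `|L2norm L u ^+ 2 - L2norm L v ^+ 2| <= 2 * L2norm L v * d + d ^+ 2.
Proof.
move=> u2 v2 /=; set d := L2norm L (fun x => u x - v x).
have w2 := inL2B u2 v2.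
have -> : L2norm L u ^+ 2 - L2norm L v ^+ 2 =
    2 * L2dot L v (fun x => u x - v x) + d ^+ 2.
  by rewrite /d !L2norm_sqr L2dotBl ?L2dotBr// (L2dotC v u); ring.
rewrite (le_trans (ler_normD _ _))// (ger0_norm (sqr_ge0 d)) lerD2r.
by rewrite normrM ger0_norm// -mulrA ler_wpM2l// L2dot_le_norm.
Qed.

(** The squared norm is convex with gradient [2 u], so its graph lies above the
    tangent at [u]. *)
Lemma L2norm_sqr_convex u v : inL2 L u -> inL2 L v ->
  L2norm L u ^+ 2 - L2norm L v ^+ 2 <= 2 * L2dot L u (fun x => u x - v x).
Proof.
move=> u2 v2; have := sqr_ge0 (L2norm L (fun x => u x - v x)).
have w2 := inL2B u2 v2.
by rewrite !L2norm_sqr L2dotBl ?L2dotBr// (L2dotC v u); lra.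
Qed.

End L2Space.

(** * Functions with a square-integrable weak derivative *)

Section Sobolev.
Context {R : realType} (L : R).
Hypothesis L_ge0 : 0 <= L.
Notation mu := (@lebesgue_measure R).
Implicit Types (u v : R -> 'cV[R]_3) (f g : R -> R).

Let mL : measurable (`[0, L] : set (measurableTypeR R)).
Proof. exact: measurable_itv. Qed.

Lemma integrable_initial_itv x f : x \in `[0, L] ->
  mu.-integrable `[0, L] (EFin \o f) -> mu.-integrable `[0, x] (EFin \o f).
Proof.
rewrite in_itv/= => /andP[_ xL]; apply: integrableS => //.
by apply: subset_itvl; rewrite bnd_simp.
Qed.

Lemma primitiveB f f' g g' : primitive L f f' -> primitive L g g' ->
  primitive L (fun x => f x - g x) (fun x => f' x - g' x).
Proof.
move=> [f'i fE] [g'i gE]; split; first exact: integrable_EFinB.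
move=> x xL.
rewrite RintegralB//; [|exact: integrable_initial_itv..].
by rewrite fE// (gE x)//; ring.
Qed.

Lemma primitiveZ (a : R) f f' : primitive L f f' ->
  primitive L (fun x => a * f x) (fun x => a * f' x).
Proof.
move=> [f'i fE]; split; first exact: integrable_EFinZl.
move=> x xL.
rewrite RintegralZl//; [|exact: integrable_initial_itv].
by rewrite fE// mulrDr.
Qed.

(** The derivative [v'] is carried as data: unlike [dx], which is a limit of
    difference quotients, this makes the notion visibly stable under linear
    operations. *)
Definition sobolev v v' : Prop :=
  inL2 L v' /\ forall i, primitive L (fun x => v x i 0) (fun x => v' x i 0).

Lemma inL2_cst (p : 'cV[R]_3) : inL2 L (fun=> p).
Proof.
exact: (@inL2_bounded _ _ _ (dotv p p)).
Qed.

Lemma inL2_entry_integrable u i : inL2 L u ->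
  mu.-integrable `[0, L] (EFin \o (fun x => u x i 0)).
Proof.
move=> u2.
apply: eq_integrable (integrable_dotv u2 (inL2_cst (delta_mx i 0))) => // x _ /=.
rewrite /dotv (bigD1 i)//= mxE !eqxx mulr1 big1 ?addr0// => j ji.
by rewrite mxE (negbTE ji) mulr0.
Qed.

Lemma inH1_sobolev u : inH1 L u -> sobolev u (dx L u).
Proof.
move=> [_ du2 uE]; split=> // i; split; first exact: inL2_entry_integrable.
by move=> x xL; rewrite uE// !mxE.
Qed.

Lemma sobolev_measurable v v' i :
  sobolev v v' -> measurable_fun `[0, L] (fun x => v x i 0).
Proof. by move=> [_ /(_ i)]; exact: primitive_measurable. Qed.

Lemma sobolev_bounded v v' : sobolev v v' ->
  exists C, forall x, x \in `[0, L] -> dotv (v x) (v x) <= C.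
Proof.
move=> [_ pv].
have entry_bounded i : exists C, forall x, x \in `[0, L] -> (v x i 0) ^+ 2 <= C.
  have [M [Mr vM]] := primitive_bounded L_ge0 (pv i).
  exists ((`|M| + 1) ^+ 2) => x xL.
  rewrite -(real_normK (num_real (v x i 0))) ler_pXn2r// ?nnegrE ?addr_ge0//.
  by apply: vM => //; rewrite (le_lt_trans (ler_norm _))// ltrDl.
have [C0 vC0] := entry_bounded 0; have [C1 vC1] := entry_bounded 1.
have [C2 vC2] := entry_bounded 2%:R; exists (C0 + C1 + C2) => x xL.
by rewrite dotvE -!expr2 !lerD ?vC0 ?vC1 ?vC2.
Qed.

Lemma sobolev_crossv_inL2 v v' u :
  sobolev v v' -> inL2 L u -> inL2 L (fun x => crossv (v x) (u x)).
Proof.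
move=> sv; have [C vC] := sobolev_bounded sv; apply: inL2_crossv vC => i.
exact: sobolev_measurable sv.
Qed.

Lemma sobolev_cst (p : 'cV[R]_3) : sobolev (fun=> p) (fun=> 0).
Proof.
split=> [|i]; first exact: inL2_cst.
split; first exact: (inL2_entry_integrable _ (inL2_cst 0)).
by move=> x _; under eq_Rintegral do rewrite mxE; rewrite Rintegral_cst// mul0r addr0.
Qed.

Lemma sobolevB u u' v v' : sobolev u u' -> sobolev v v' ->
  sobolev (fun x => u x - v x) (fun x => u' x - v' x).
Proof.
move=> [u2 pu] [v2 pv]; split=> [|i]; first exact: inL2B.
have := primitiveB (pu i) (pv i).
by congr primitive; apply/funext => x; rewrite !mxE.
Qed.

Lemma sobolev_crossv (p : 'cV[R]_3) u u' : sobolev u u' ->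
  sobolev (fun x => crossv p (u x)) (fun x => crossv p (u' x)).
Proof.
move=> [u2 pu]; split=> [|i].
  exact: (sobolev_crossv_inL2 (sobolev_cst p)).
have := primitiveB (primitiveZ (p (i + 1) 0) (pu (i + 2%:R)))
  (primitiveZ (p (i + 2%:R) 0) (pu (i + 1))).
by congr primitive; apply/funext => x; rewrite !mxE.
Qed.

(** The boundary terms vanish because of the conditions on [u]; this will be
    used with [u = m_x], which satisfies the Neumann conditions. *)
Lemma sobolev_by_parts u u' v v' : sobolev u u' -> sobolev v v' ->
  u 0 = 0 -> u L = 0 -> L2dot L u' v = - L2dot L u v'.
Proof.
move=> [u2 pu] [v2 pv] u0 uL.
have sum_entries (w z : R -> 'cV[R]_3) :
    (forall i, mu.-integrable `[0, L] (EFin \o (fun x => w x i 0 * z x i 0))) ->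
    L2dot L w z = \int[mu]_(x in `[0, L]) (w x 0 0 * z x 0 0)
      + \int[mu]_(x in `[0, L]) (w x 1 0 * z x 1 0)
      + \int[mu]_(x in `[0, L]) (w x 2%:R 0 * z x 2%:R 0).
  move=> wz; rewrite -RintegralD// -RintegralD//; last exact: integrable_EFinD.
  by apply: eq_Rintegral => x _; exact: dotvE.
have entry_parts i : \int[mu]_(x in `[0, L]) (v x i 0 * u' x i 0) =
    - \int[mu]_(x in `[0, L]) (u x i 0 * v' x i 0).
  have := primitive_by_parts L_ge0 (pu i) (pv i).
  by rewrite u0 uL mxE !mul0r subrr addrC => /eqP; rewrite addr_eq0 => /eqP.
rewrite L2dotC !sum_entries ?entry_parts ?opprD// => i.
- exact: primitive_mul_integrable (pu i) (pv i).1.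
- exact: primitive_mul_integrable (pv i) (pu i).1.
Qed.

End Sobolev.

(** * The difference-quotient derivative of constant functions *)

Section Derivative.
Context {R : realType} (L : R).
Hypothesis L_gt0 : 0 < L.
Notation mu := (@lebesgue_measure R).
Implicit Types u v : R -> 'cV[R]_3.

(** [dx] only sees increments inside [[0, L]]; in particular it ignores both the
    values outside that interval and additive constants. *)
Lemma eq_dx u v :
  (forall x y, x \in `[0, L] -> y \in `[0, L] -> u y - u x = v y - v x) ->
  forall x, x \in `[0, L] -> dx L u x = dx L v x.
Proof.
move=> uv x xL; rewrite /dx; congr (lim _).
apply/funext => A; apply/propext; rewrite !nbhs_filterE /fmap/=.
by split; apply: filterS2 (withinT _ _) => y yL /=; rewrite uv.
Qed.

(** Without this, the limit defining [dx] would be an arbitrary value. *)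
Lemma within_itv_dnbhs_proper x :
  x \in `[0, L] -> ProperFilter (within `[0, L] x^').
Proof.
rewrite in_itv/= => /andP[x0 xL]; split; last exact: within_filter.
move=> /nbhs_ballP[e /= e0 xe].
suff [y [xy ye y0L]] : exists y, [/\ y != x, `|x - y| < e & y \in `[0, L]].
  exact: (xe y ye xy y0L).
have [x_ltL|Lx] := ltP x L.
- pose d := Num.min (e / 2) (L - x).
  have d0 : 0 < d by rewrite lt_min subr_gt0 x_ltL divr_gt0.
  have [de dL] : d <= e / 2 /\ d <= L - x by rewrite !ge_min !lexx orbT.
  exists (x + d); rewrite in_itv/= opprD addrA subrr sub0r normrN gtr0_norm//.
  by split; [rewrite gt_eqF; lra|lra|apply/andP; split; lra].
- pose d := Num.min (e / 2) x.
  have d0 : 0 < d by rewrite lt_min divr_gt0// (lt_le_trans L_gt0).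
  have [de dL] : d <= e / 2 /\ d <= x by rewrite !ge_min !lexx orbT.
  exists (x - d); rewrite in_itv/= opprB addrCA subrr addr0 gtr0_norm//.
  by split; [rewrite lt_eqF; lra|lra|apply/andP; split; lra].
Qed.

Lemma dx_cst (p : 'cV[R]_3) x : x \in `[0, L] -> dx L (fun=> p) x = 0.
Proof.
move=> xL; have PF := within_itv_dnbhs_proper xL; rewrite /dx.
under eq_fun do rewrite subrr scaler0.
exact: lim_cst.
Qed.

Lemma dx_locally_cst u (p : 'cV[R]_3) : {in `[0, L], forall x, u x = p} ->
  {in `[0, L], forall x, dx L u x = 0}.
Proof.
move=> up x xL; rewrite -(dx_cst p xL); apply: eq_dx => // y z yL zL.
by rewrite !up.
Qed.

Lemma inH1_cst u (p : 'cV[R]_3) : {in `[0, L], forall x, u x = p} -> inH1 L u.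
Proof.
move=> up; have du := dx_locally_cst up; split.
- by apply: eq_inL2 (inL2_cst L p) => x xL; rewrite up.
- by apply: eq_inL2 (inL2_cst L 0) => x xL; rewrite du.
- move=> x xL; rewrite !up// ?in_itv/= ?lexx ?ltW//.
  apply/matrixP => i j; rewrite !mxE.
  rewrite (@eq_Rintegral _ _ _ _ _ (cst 0)) ?Rintegral_cst ?mul0r ?addr0//.
  move=> y; rewrite inE/= => y0x; rewrite du ?mxE//.
  by move: xL y0x; rewrite !in_itv/= => /andP[_ xL] /andP[-> /le_trans->].
Qed.

Lemma inD_cst (p : 'cV[R]_3) : inD L (cst p).
Proof.
have dp x : x \in `[0, L] -> dx L (cst p) x = 0 by exact: dx_cst.
split; [exact: (inH1_cst (p := p))|exact: inH1_cst dp| |];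
  by rewrite dp// in_itv/= ?lexx ltW.
Qed.

End Derivative.

(** * Exponential decay from a one-sided differential inequality *)

(** The hypothesis says that the left upper Dini derivative of [V] is at most
    [- k V].  Let [V t * expR (a * t)] be maximal on [[0, T]] at [tm].  If [tm]
    and [V tm] are positive, then just before [tm] the function [V] is above
    [V tm * (1 + c * h)] with [c > a], whereas maximality puts it below
    [V tm * expR (a * h)]: a contradiction for small [h].  So the maximum is
    reached at [0], or is nonpositive. *)
Lemma left_decay_exp (R : realType) (V : R -> R) (k a T : R) :
  0 < a -> a < k -> 0 <= T -> 0 <= V 0 -> {within `[0, T], continuous V} ->
  (forall t e, 0 < t -> t <= T -> 0 < e -> exists2 d, 0 < d &
     forall s, 0 <= s -> t - d < s -> s < t ->
       V t - V s <= (t - s) * (e - k * V t)) ->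
  V T <= expR (- a * T) * V 0.
Proof.
move=> a0 ak T0 V0 cV decay; pose W t := V t * expR (a * t).
suff : W T <= W 0.
  rewrite /W mulr0 expR0 mulr1 mulNr expRN => WT.
  by rewrite mulrC ler_pdivlMr ?expR_gt0.
have cW : {within `[0, T], continuous W}.
  move=> x; apply: cvgM; first exact: cV.
  have : continuous (fun t : R => expR (a * t)).
    move=> t; apply: continuous_comp; last exact: continuous_expR.
    by apply: cvgMl_tmp; exact: cvg_id.
  by move=> /(@continuous_subspaceT _ _ `[0, T]); exact.
have [tm] := EVT_max T0 cW; rewrite in_itv/= => /andP[tm0 tmT] Wmax.
have WTm : W T <= W tm by apply: Wmax; rewrite in_itv/= T0 lexx.
have [Vm|Vm] := leP (V tm) 0.
  rewrite (le_trans WTm)// /W mulr0 expR0 mulr1 (le_trans _ V0)//.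
  by rewrite mulr_le0_ge0 ?expR_ge0.
move: tm0; rewrite le_eqVlt => /predU1P[tmE|tm0].
  by move: WTm; rewrite -tmE.
exfalso.
have [c [ac ck]] : exists c, a < c /\ c < k by exists ((k + a) / 2); split; lra.
have c0 := lt_trans a0 ac.
have [|d d0 dec] := decay tm ((k - c) * V tm) tm0 tmT.
  by rewrite mulr_gt0// subr_gt0.
(* [h < (c - a) / (a * c)] means [1 < (1 + c * h) * (1 - a * h)], which is
   incompatible with [1 + c * h <= expR (a * h) <= (1 - a * h)^-1]. *)
pose h := Num.min (Num.min d tm) ((c - a) / (a * c)) / 2.
have q0 : 0 < (c - a) / (a * c) by apply: divr_gt0; rewrite ?subr_gt0 ?mulr_gt0.
have h0 : 0 < h by rewrite divr_gt0// !lt_min d0 tm0 q0.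
have [hd htm hq] : [/\ h < d, h <= tm & h < (c - a) / (a * c)].
  have min_half (x y : R) : 0 < x -> y <= x -> y / 2 < x by lra.
  split; [|apply: ltW|]; apply: min_half => //; rewrite !ge_min lexx ?orbT//.
have hac : h * (a * c) < c - a by rewrite -ltr_pdivlMr// mulr_gt0.
have := dec (tm - h); rewrite subr_ge0 htm ltrD2l ltrN2 hd gtrBl h0 opprB.
rewrite addrCA subrr addr0 => /(_ isT isT isT) Vdec.
have : W (tm - h) <= W tm.
  by apply: Wmax; rewrite in_itv/= subr_ge0 htm (le_trans _ tmT)// gerBl ltW.
rewrite /W mulrBr expRD expRN mulrA ler_pdivrMr ?expR_gt0//.
rewrite [leRHS]mulrAC ler_pM2r ?expR_gt0// => WV.
have : expR (a * h) * (1 - a * h) <= 1.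
  have := expR_ge1Dx (- (a * h)); rewrite expRN => ah.
  by rewrite (le_trans (ler_wpM2l (expR_ge0 _) ah))// divff// gt_eqF// expR_gt0.
have ah1 : 0 < 1 - a * h by nra.
have ch : 1 + c * h <= expR (a * h).
  rewrite -(ler_pM2l Vm) (le_trans _ WV)//; nra.
have := ler_wpM2r (ltW ah1) ch; nra.
Qed.

(** * Dissipation of the weighted energy *)

Section Energy.
Context {R : realType} (L nu k c : R) (r : 'cV[R]_3).
Hypotheses (L_gt0 : 0 < L) (nu_ge0 : 0 <= nu) (c_gt0 : 0 < c).
Hypothesis r_unit : dotv r r = 1.
Notation mu := (@lebesgue_measure R).
Implicit Types u v : R -> 'cV[R]_3.

Let L_ge0 : 0 <= L := ltW L_gt0.

(** The weight [c] on the derivative is what lets the damping term, which acts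
    on [u_xx], dominate its own contribution to the growth of [u - r]. *)
Definition energy u : R :=
  L2norm L (fun x => u x - r) ^+ 2 + c * L2norm L (dx L u) ^+ 2.

(** Half the L_2 gradient of [energy] on functions satisfying the Neumann
    conditions. *)
Definition energy_gradient u : R -> 'cV[R]_3 :=
  fun x => u x - r - c *: dx L (dx L u) x.

Lemma energy_ge0 u : 0 <= energy u.
Proof. by apply: addr_ge0; [|apply: mulr_ge0; first exact: ltW]; exact: sqr_ge0. Qed.

Lemma inL2_sub_cst u : inH1 L u -> inL2 L (fun x => u x - r).
Proof. by case=> u2 _ _; exact: inL2B u2 (inL2_cst L r). Qed.

Lemma energy_gradient_inL2 u : inD L u -> inL2 L (energy_gradient u).
Proof.
move=> [u1 [_ w2 _] _ _]; apply: inL2B; first exact: inL2_sub_cst.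
exact: inL2Z.
Qed.

Lemma LLrhs_inL2 u : inD L u -> inL2 L (LLrhs L nu k r u).
Proof.
move=> [u1 [_ w2 _] _ _]; have su := inH1_sobolev u1.
have [u2 _ _] := u1.
have z2 := sobolev_crossv_inL2 L_ge0 su w2.
have zz2 := sobolev_crossv_inL2 L_ge0 su z2.
exact: inL2D (inL2B z2 (inL2Z nu zz2)) (inL2Z k (inL2B (inL2_cst L r) u2)).
Qed.

(** The energy is convex, so its increment is bounded by its differential at
    [u]; the Neumann conditions turn [<u_x, (u - v)_x>] into
    [- <u_xx, u - v>], which makes sense for the L_2 increment [u - v]. *)
Lemma energy_diff_le u v : inD L u -> inH1 L v ->
  energy u - energy v <= 2 * L2dot L (energy_gradient u) (fun x => u x - v x).
Proof.
have lin (a a' b b' p q : R) : a - a' <= 2 * p -> c * (b - b') <= c * (2 * q) ->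
  a + c * b - (a' + c * b') <= 2 * (p - c * - q) by lra.
move=> [u1 du1 du0 duL] v1; have [u2 du2 _] := u1; have [v2 dv2 _] := v1.
have [_ ddu2 _] := du1.
have w2 := inL2B u2 v2; have ur2 := inL2_sub_cst u1.
have Hu := L2norm_sqr_convex ur2 (inL2_sub_cst v1).
have Hd := L2norm_sqr_convex du2 dv2.
have := sobolev_by_parts L_ge0 (inH1_sobolev du1)
  (sobolevB (inH1_sobolev u1) (inH1_sobolev v1)) du0 duL.
move=> parts; have {}Hd := ler_wpM2l (ltW c_gt0) Hd.
have e : L2dot L (fun x => u x - r) (fun x => u x - r - (v x - r)) =
    L2dot L (fun x => u x - r) (fun x => u x - v x).
  by apply: eq_L2dot => // x _; rewrite opprB addrA subrK.
rewrite e in Hu.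
rewrite /energy /energy_gradient L2dotBl ?L2dotZl//; last exact: inL2Z.
rewrite parts.
exact: lin Hu Hd.
Qed.

(** Integrating the pointwise bound, the precession term drops out:
    [r . (u x u_xx) = u_xx . (r x u)] integrates to
    [- \int u_x . (r x u_x) = 0]. *)
Lemma energy_dissipation u : inD L u ->
  L2dot L (energy_gradient u) (LLrhs L nu k r u) <=
  - (k - nu / (4 * c)) * L2norm L (fun x => u x - r) ^+ 2
  - c * k * L2norm L (dx L u) ^+ 2.
Proof.
move=> uD; have [u1 du1 du0 duL] := uD; have [u2 du2 _] := u1.
have [_ w2 _] := du1; set w := dx L (dx L u) in w2 *.
have su := inH1_sobolev u1; have sdu := inH1_sobolev du1.
have ur2 := inL2_sub_cst u1.
have r2 := inL2_cst L r.
have uw2 := sobolev_crossv_inL2 L_ge0 su w2.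
have torque : L2dot L (fun=> r) (fun x => crossv (u x) (w x)) = 0.
  transitivity (L2dot L w (fun x => crossv r (u x))).
    by apply: eq_Rintegral => x _; rewrite 2!dotv_crossv_cycle.
  rewrite (sobolev_by_parts L_ge0 sdu (sobolev_crossv L_ge0 r su) du0 duL).
  rewrite (_ : L2dot _ _ _ = \int[mu]_(x in `[0, L]) 0).
    by rewrite Rintegral_cst// mul0r oppr0.
  by apply: eq_Rintegral => x _; rewrite dotv_crossv_r.
have grad : L2dot L w (fun x => u x - r) = - L2norm L (dx L u) ^+ 2.
  rewrite (sobolev_by_parts L_ge0 sdu (sobolevB su (sobolev_cst L r)) du0 duL).
  by rewrite L2norm_sqr; congr (- _); apply: eq_L2dot => // x _; rewrite subr0.
have i1 := integrable_dotv r2 uw2.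
have i2 := integrable_dotv ur2 ur2.
have i3 := integrable_dotv w2 ur2.
have mL : measurable (`[0, L] : set (measurableTypeR R)) by exact: measurable_itv.
apply: (@le_trans _ _ (\int[mu]_(x in `[0, L])
  (- 1 * dotv r (crossv (u x) (w x))
  - (k - nu / (4 * c)) * dotv (u x - r) (u x - r)
  + c * k * dotv (w x) (u x - r)))).
  apply: le_Rintegral => //.
  - exact: integrable_dotv (energy_gradient_inL2 uD) (LLrhs_inL2 uD).
  - by apply: integrable_EFinD => //; first apply: integrable_EFinB => //;
      exact: integrable_EFinZl.
  - by move=> x _; rewrite mulN1r; exact: dissipation_le.
rewrite RintegralD//; last 2 first.
- by apply: integrable_EFinB => //; exact: integrable_EFinZl.
- exact: integrable_EFinZl.
rewrite RintegralB ?RintegralZl//; [|exact: integrable_EFinZl..].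
rewrite -[X in -1 * X]/(L2dot L (fun=> r) (fun x => crossv (u x) (w x))).
rewrite -[X in _ + c * k * X]/(L2dot L w (fun x => u x - r)).
rewrite -[X in _ - _ * X]/(L2dot L (fun x => u x - r) (fun x => u x - r)).
by rewrite torque grad -L2norm_sqr mulr0 sub0r mulrN mulNr.
Qed.

End Energy.

(** * The energy along a solution *)

Section Trajectory.
Context {R : realType} (L nu k c : R) (r : 'cV[R]_3).
Hypotheses (L_gt0 : 0 < L) (nu_ge0 : 0 <= nu) (c_gt0 : 0 < c).
Hypothesis r_unit : dotv r r = 1.
Hypothesis c_large : nu <= 2 * c * k.
Variables (m0 : R -> 'cV[R]_3) (m : R -> R -> 'cV[R]_3).
Hypothesis m_sol : LLsolution L nu k r m0 m.

(** The difference quotient of [m] converges to the right-hand side in L_2, so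
    testing it against the fixed L_2 function [energy_gradient (m t)] passes to
    the limit.  Only [s < t] is possible: convexity gives no upper bound for
    increments to the right. *)
Lemma energy_left_decay (t e : R) : 0 < t -> 0 < e -> exists2 d, 0 < d &
  forall s, 0 <= s -> t - d < s -> s < t ->
    energy L c r (m t) - energy L c r (m s) <=
    (t - s) * (e - k * energy L c r (m t)).
Proof.
have ck0 : 0 <= c * k by have := le_trans nu_ge0 c_large; lra.
have nuc : nu / (4 * c) <= k / 2.
  by rewrite ler_pdivrMr ?mulr_gt0// (le_trans c_large)//; lra.
have rate (X A B : R) : 0 <= A -> 0 <= B ->
    X <= - (k - nu / (4 * c)) * A - c * k * B -> 2 * X <= - (k * (A + c * B)).
  move=> A0 B0; have := mulr_ge0 ck0 B0.
  have := ler_wpM2r A0 nuc; lra.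
have young (N x y : R) : 0 <= N -> 0 < y -> x <= N * (y / (2 * (N + 1))) ->
    2 * x <= y.
  move=> N0 y0 xy; have N1 : 0 < N + 1 by rewrite ltr_wpDl.
  have Ny : N * (y / (2 * (N + 1))) = y / 2 - y / (2 * (N + 1)).
    by field; rewrite gt_eqF.
  have : 0 < y / (2 * (N + 1)) by rewrite divr_gt0 ?mulr_gt0.
  by rewrite Ny in xy; lra.
move=> t0 e0; have [_ mH1 _ mD mdt] := m_sol.
have tD := mD _ t0; have tH1 := mH1 _ (ltW t0).
set F := LLrhs L nu k r (m t) in mdt; set G := energy_gradient L c r (m t).
have G2 : inL2 L G := energy_gradient_inL2 c r tD.
have F2 : inL2 L F := LLrhs_inL2 nu k r L_gt0 tD.
have GF : 2 * L2dot L G F <= - (k * energy L c r (m t)).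
  apply: rate (energy_dissipation k L_gt0 nu_ge0 c_gt0 r_unit tD);
    exact: sqr_ge0.
pose N := L2norm L G; have N0 : 0 <= N := L2norm_ge0 L G.
have N1 : 0 < 2 * (N + 1) by rewrite mulr_gt0// ltr_wpDl.
have /cvgr0Pnorm_le/(_ _ (divr_gt0 e0 N1)) := mdt _ t0.
move=> /nbhs_ballP[d /= d0 qd]; exists d => // s s0 ts st.
pose q x := (s - t)^-1 *: (m s x - m t x) - F x.
have q_le : L2norm L q <= e / (2 * (N + 1)).
  have st_d : ball (0 : R) d (s - t).
    by rewrite /ball/= sub0r normrN ltr0_norm ?subr_lt0// opprB; lra.
  have := qd _ st_d; rewrite /= lt_eqF ?subr_lt0// => /(_ isT).
  by rewrite [t + _]addrC subrK; exact: le_trans (ler_norm _).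
have ms2 : inL2 L (m s) by case: (mH1 _ s0).
have mt2 : inL2 L (m t) by case: tH1.
have q2 : inL2 L q by exact: inL2B (inL2Z _ (inL2B ms2 mt2)) F2.
rewrite (le_trans (energy_diff_le r L_gt0 c_gt0 tD (mH1 _ s0)))//.
have -> : L2dot L (energy_gradient L c r (m t)) (fun x => m t x - m s x) =
    (t - s) * (L2dot L G q + L2dot L G F).
  rewrite -L2dotDr// -L2dotZr//; last exact: inL2D.
  apply: eq_L2dot => // x _; rewrite /q subrK -opprB -(opprB t s).
  by rewrite invrN scaleNr scalerN scalerA divff ?scale1r ?subr_eq0 ?gt_eqF.
rewrite mulrCA; apply: ler_wpM2l; first by rewrite subr_ge0 ltW.
rewrite mulrDr lerD//.
have Gq := le_trans (ler_norm _) (L2dot_le_norm G2 q2).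
rewrite -/N in Gq.
exact: (young N) (le_trans Gq (ler_wpM2l N0 q_le)).
Qed.

Lemma energy_continuous T : {within `[0, T], continuous (energy L c r \o m)}.
Proof.
have [_ mH1 mC _ _] := m_sol.
apply/subspace_continuousP => t; rewrite /= in_itv/= => /andP[t0 _].
have [] := mC _ t0.
set d := fun s => L2norm L (fun x => m s x - m t x).
set d' := fun s => L2norm L (fun x => dx L (m s) x - dx L (m t) x).
move=> d0 d'0; pose a := L2norm L (fun x => m t x - r).
pose b := L2norm L (dx L (m t)).
pose B s := 2 * a * d s + d s ^+ 2 + c * (2 * b * d' s + d' s ^+ 2).
have B0 : B s @[s --> within `[0, +oo[ (nbhs t)] --> 0.
  rewrite [X in _ --> X](_ : 0 = 2 * a * 0 + 0 ^+ 2 + c * (2 * b * 0 + 0 ^+ 2));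
    last by ring.
  apply: cvgD; first by apply: cvgD; [exact: cvgMl_tmp d0|exact: (cvgM d0 d0)].
  by apply: cvgMl_tmp; apply: cvgD; [exact: cvgMl_tmp d'0|exact: (cvgM d'0 d'0)].
suff cE : energy L c r (m s) @[s --> within `[0, +oo[ (nbhs t)]
    --> energy L c r (m t).
  apply: cvg_trans cE; apply: cvg_app; apply: within_subset => x /=.
  by rewrite !in_itv/= => /andP[->].
apply/cvgrPdist_le => e e0.
move/cvgr0Pnorm_le/(_ _ e0) : B0; apply: filterS2 (withinT _ _) => s /=.
rewrite in_itv/= andbT => s0 /(le_trans (ler_norm _)); apply: le_trans.
have sr2 := inL2_sub_cst r (mH1 _ s0); have tr2 := inL2_sub_cst r (mH1 _ t0).
have [_ ds2 _] := mH1 _ s0; have [_ dt2 _] := mH1 _ t0.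
have H1 := L2norm_sqr_dist sr2 tr2; have H2 := L2norm_sqr_dist ds2 dt2.
have dE : L2norm L (fun x => m s x - r - (m t x - r)) = d s.
  by congr (L2norm L _); apply/funext => x; rewrite opprB addrA subrK.
rewrite /= dE in H1; rewrite distrC.
have lin (x x' y y' p q : R) : `|x - x'| <= p -> `|y - y'| <= q ->
    `|x + c * y - (x' + c * y')| <= p + c * q.
  move=> xp yq; have -> : x + c * y - (x' + c * y') = x - x' + c * (y - y').
    by ring.
  by rewrite (le_trans (ler_normD _ _))// lerD// normrM gtr0_norm// ler_pM2l.
exact: lin H1 H2.
Qed.

End Trajectory.

(** * Global exponential stability *)

Lemma L2norm_eq (R : realType) (L : R) (u v : R -> 'cV[R]_3) :
  {in `[0, L], u =1 v} -> L2norm L u = L2norm L v.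
Proof. by move=> uv; congr (Num.sqrt _); exact: eq_L2dot. Qed.

Lemma H1norm_sqr_sub_cst (R : realType) (L : R) (r : 'cV[R]_3)
    (u : R -> 'cV[R]_3) :
  H1norm L (fun x => u x - r) ^+ 2 = energy L 1 r u.
Proof.
rewrite sqr_sqrtr ?addr_ge0 ?sqr_ge0// /energy mul1r.
rewrite (@L2norm_eq _ L (dx L (fun x => u x - r)) (dx L u))// => x xL.
by apply: eq_dx => // y z _ _; rewrite opprB addrA subrK.
Qed.

Lemma eq_energy (R : realType) (L c : R) (r : 'cV[R]_3)
    (u v : R -> 'cV[R]_3) :
  {in `[0, L], u =1 v} -> energy L c r u = energy L c r v.
Proof.
move=> uv; rewrite /energy.
rewrite (@L2norm_eq _ L (fun x => u x - r) (fun x => v x - r)); last first.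
  by move=> x xL; rewrite uv.
rewrite (@L2norm_eq _ L (dx L u) (dx L v))// => x xL.
by apply: eq_dx => // y z yL zL; rewrite !uv.
Qed.

Unset Implicit Arguments.

Theorem theorem12 (R : realType) (L nu k : R) (r : 'cV[R]_3)
    (L_gt0 : 0 < L) (nu_ge0 : 0 <= nu) (r_unit : r^T *m r = 1%:M)
    (k_gt0 : 0 < k) (k_large : 8 * nu * L ^+ 4 < k) :
  LLequilibrium L nu k r r /\ LLglobally_exp_stable_H1 L nu k r r.
Proof.
have rr : dotv r r = 1.
  transitivity ((r^T *m r) 0 0); last by rewrite r_unit mxE.
  by rewrite mxE; apply: eq_bigr => i _; rewrite mxE.
split.
  split; first exact: inD_cst.
  move=> x xL; rewrite /LLrhs subrr scaler0 addr0.
  have -> : dx L (dx L (cst r)) x = 0.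
    by apply: (dx_locally_cst L_gt0 (p := 0)) xL => // y yL; exact: dx_cst.
  by rewrite !crossv0 scaler0 subrr.
(* [c >= 1] compares the energy with the H_1-norm, and [c >= nu / (2 k)] makes
   the loss [nu / (4 c)] in the dissipation at most [k / 2]. *)
pose c := 1 + nu / (2 * k).
have c1 : 1 <= c by rewrite lerDl divr_ge0// mulr_ge0// ltW.
have c0 : 0 < c := lt_le_trans ltr01 c1.
have c_large : nu <= 2 * c * k.
  have -> : 2 * c * k = 2 * k + nu by rewrite /c; field; rewrite gt_eqF.
  by rewrite lerDr mulr_ge0// ltW.
exists (Num.sqrt c), (k / 4); split.
- by rewrite -[leLHS]sqrtr1 ler_wsqrtr.
- by rewrite divr_gt0.
move=> m0 m m0H1 m_sol t t0.
have [m0E _ _ _ _] := m_sol.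
have decay : energy L c r (m t) <= expR (- (k / 2) * t) * energy L c r m0.
  rewrite -(@eq_energy _ L c r (m 0) m0); last by move=> x; exact: m0E.
  apply: (@left_decay_exp _ (energy L c r \o m) k) => //=.
  - by rewrite divr_gt0.
  - by lra.
  - exact: energy_ge0 c0 _.
  - exact: (energy_continuous c0 m_sol).
  - move=> s e s0 _ e0.
    exact: (energy_left_decay L_gt0 nu_ge0 c0 rr c_large m_sol s0 e0).
have H1norm_ge0 u : 0 <= H1norm L u := sqrtr_ge0 _.
move: (H1norm_ge0 (fun x => m t x - r)) (H1norm_ge0 (fun x => m0 x - r)).
move: (H1norm_sqr_sub_cst L r (m t)) (H1norm_sqr_sub_cst L r m0).
move: (H1norm L (fun x => m t x - r)) (H1norm L (fun x => m0 x - r)).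
move=> hm h0 hmE h0E hm_ge0 h0_ge0.
rewrite -(@ler_pXn2r _ 2)// ?nnegrE ?mulr_ge0 ?sqrtr_ge0 ?expR_ge0//.
rewrite !exprMn hmE h0E (sqr_sqrtr (ltW c0)) -expRM_natl.
have -> : (2%:R * (- (k / 4) * t)) = - (k / 2) * t by field.
have weight u : energy L 1 r u <= energy L c r u <= c * energy L 1 r u.
  rewrite /energy mul1r mulrDr; apply/andP; split.
    by rewrite lerD2l ler_peMl ?sqr_ge0.
  by rewrite lerD2r ler_peMl ?sqr_ge0.
have /andP[Et _] := weight (m t); have /andP[_ E0] := weight m0.
rewrite (le_trans Et)// (le_trans decay)// mulrAC [leRHS]mulrC.
by rewrite ler_wpM2l ?expR_ge0.
Qed.
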